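(* Let $\mathscr C$ be a category and let $F:\mathscr C^{\mathrm{op}}\to\mathbf{Cat}$ be a tangent indexing functor, with fibre tangent structures ${}_X\mathbb T=({}_XT,{}_Xp,{}_X0,{}_X{+},{}_X\ell,{}_Xc)$ on $F(X)$ and natural isomorphisms ${}_fT:F(f)\circ{}_YT\Rightarrow{}_XT\circ F(f)$ for $f:X\to Y$. Then the pseudocone category $\mathbf{PC}(F)$ is a tangent category with tangent structure $\mathbb T=(\underline T,\underline p,\underline 0,\underline +,\underline\ell,\underline c)$, where $\underline T:\mathbf{PC}(F)\to\mathbf{PC}(F)$ is the functor sending $(A,\Sigma_A)$ to the object with components ${}_XT({}_XA)$ and transition isomorphisms ${}_XT(\tau^A_f)\circ({}_fT)_{{}_YA}$ for $f:X\to Y$ (and sending a morphism $({}_X\rho)_X$ to $({}_XT({}_X\rho))_X$), and where $\underline p,\underline 0,\underline +,\underline\ell,\underline c$ are the natural transformations whose $X$-components at an object $(A,\Sigma_A)$ are $({}_Xp)_{{}_XA},({}_X0)_{{}_XA},({}_X{+})_{{}_XA},({}_X\ell)_{{}_XA},({}_Xc)_{{}_XA}$ respectively.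
   Context: Tangent categories. A tangent structure $\mathbb T=(T,p,0,+,\ell,c)$ on a category $\mathscr D$ consists of a functor $T:\mathscr D\to\mathscr D$ and natural transformations $p:T\Rightarrow\mathrm{id}$, $0:\mathrm{id}\Rightarrow T$, $+:T_2\Rightarrow T$, $\ell:T\Rightarrow T^2$, $c:T^2\Rightarrow T^2$ such that: (1) for every object $A$ and $n\in\mathbb N$ the $n$-fold pullback power $T_nA$ of $p_A:TA\to A$ exists and is preserved by all $T^m$; (2) $(p_A,+_A,0_A)$ is a commutative monoid in $\mathscr D_{/A}$; (3) $T(p_A)\ell_A=0_Ap_A$, $\ell_A\circ{+_A}=T(+_A)\circ\langle\ell_A\pi_1,\ell_A\pi_2\rangle$, $\ell_A0_A=T(0_A)0_A$; (4) $p_{TA}c_A=T(p_A)$, $c_A\circ T(+_A)={+_{TA}}\circ\langle c_AT(\pi_1),c_AT(\pi_2)\rangle$, $c_AT(0_A)=0_{TA}$; (5) $c_Ac_A=\mathrm{id}$, $c_A\ell_A=\ell_A$, $T(\ell_A)\ell_A=\ell_{TA}\ell_A$, $c_{TA}T(c_A)c_{TA}=T(c_A)c_{TA}T(c_A)$, $c_{TA}T(c_A)\ell_{TA}=T(\ell_A)c_A$; (6) $T(+_A)\circ\langle\ell_A\pi_1,0_{TA}\pi_2\rangle:T_2A\to T^2A$ is an equalizer of $T(p_A)$ and $0_A\,p_A\,p_{TA}:T^2A\rightrightarrows TA$. Morphisms. A morphism of tangent categories $(\mathscr D,\mathbb T)\to(\mathscr E,\mathbb S)$, with $\mathbb S=(S,q,0',\oplus,\ell',c')$,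 is a pair $(H,\alpha)$ with $H:\mathscr D\to\mathscr E$ a functor and $\alpha:H\circ T\Rightarrow S\circ H$ natural with $(q H)\alpha=Hp$, $\alpha (H0)=0'H$, $\alpha (H{+})=(\oplus H)\alpha_2$ ($\alpha_2:HT_2\Rightarrow S_2H$ induced by $\alpha$), $(\ell' H)\alpha=(S\alpha)(\alpha T)(H\ell)$, $(c'H)(S\alpha)(\alpha T)=(S\alpha)(\alpha T)(Hc)$. It is strong if $\alpha$ is invertible and $H$ preserves the pullbacks and equalizers of the tangent structure. Tangent indexing functors. Let $\mathscr C$ be a ($1$-)category. Pseudofunctors $F:\mathscr C^{\mathrm{op}}\to\mathbf{Cat}$ are normalized ($F(\mathrm{id})=\mathrm{id}$) with compositors $\phi_{f,g}:F(f)F(g)\Rightarrow F(g\circ f)$ for $X\xrightarrow fY\xrightarrow gZ$. $F$ is a tangent indexing functor if (i) each $F(X)$ is equipped with a tangent structure ${}_X\mathbb T$; (ii) for each $f:X\to Y$ there is a natural isomorphism ${}_fT:F(f)\circ{}_YT\Rightarrow{}_XT\circ F(f)$ such that $(F(f),{}_fT):(F(Y),{}_Y\mathbb T)\to(F(X),{}_X\mathbb T)$ is a strong tangent morphism; (iii) the functors ${}_XT$ together with the isomorphisms ${}_fT^{-1}$ form a pseudonatural transformation $T:F\Rightarrow F$. Pseudocone category $\mathbf{PC}(F)$. Objects $(A,\Sigma_A)$: families of objects ${}_XA\in F(X)$, $X\in\mathscr C$, with isomorphisms $\tau^A_f:F(f)({}_YA)\to{}_XA$ for each $f:X\to Y$,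 satisfying $\tau^A_{g\circ f}\circ\phi_{f,g}=\tau^A_f\circ F(f)(\tau^A_g)$. Morphisms $(A,\Sigma_A)\to(B,\Sigma_B)$: families ${}_X\rho:{}_XA\to{}_XB$ with $\tau^B_f\circ F(f)({}_Y\rho)={}_X\rho\circ\tau^A_f$ for all $f:X\to Y$. It is the pseudolimit of $F$ in $\mathbf{Cat}$. *)

(* Defs.v *)
From mathcomp Require Import all_boot.
From Stdlib Require Import FunctionalExtensionality ProofIrrelevance.
From Stdlib Require Import IndefiniteDescription.

Set Implicit Arguments.
Unset Strict Implicit.
Unset Printing Implicit Defensive.

Declare Scope cat_scope.
Delimit Scope cat_scope with cat.
Local Open Scope cat_scope.

Record Category := MkCategory {
  Obj :> Type;
  Hom : Obj -> Obj -> Type;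
  idm : forall A, Hom A A;
  comp : forall A B C, Hom B C -> Hom A B -> Hom A C;
  comp_idl : forall A B (f : Hom A B), comp (idm B) f = f;
  comp_idr : forall A B (f : Hom A B), comp f (idm A) = f;
  compA : forall A B C D (h : Hom C D) (g : Hom B C) (f : Hom A B),
    comp h (comp g f) = comp (comp h g) f }.

Arguments Hom {c} _ _.
Arguments idm {c} A.
Arguments comp {c A B C} _ _.
Arguments comp_idl {c A B} f.
Arguments comp_idr {c A B} f.
Arguments compA {c A B C D} h g f.

Notation "g ∘ f" := (comp g f) (at level 40, left associativity) : cat_scope.

Definition is_iso (D : Category) (A B : D) (f : Hom A B) : Prop :=
  exists g : Hom B A, g ∘ f = idm A /\ f ∘ g = idm B.

(** The identity of [A], seen as a morphism to an object equal to [A]. *)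
Definition eqhom (D : Category) (A B : D) (e : A = B) : Hom A B :=
  match e in _ = B' return Hom A B' with erefl => idm A end.

Record Functor (D E : Category) := MkFunctor {
  fob :> D -> E;
  fmap : forall A B, Hom A B -> Hom (fob A) (fob B);
  fmap_id : forall A, fmap (idm A) = idm (fob A);
  fmap_comp : forall A B C (g : Hom B C) (f : Hom A B),
    fmap (g ∘ f) = fmap g ∘ fmap f }.

Arguments fmap {D E} G {A B} _ : rename.

Definition idF (D : Category) : Functor D D :=
  @MkFunctor D D (fun A => A) (fun A B f => f)
    (fun A => erefl) (fun A B C g f => erefl).

Lemma compF_id (D E K : Category) (G : Functor E K) (H : Functor D E) (A : D) :
  fmap G (fmap H (idm A)) = idm (G (H A)).
Proof. by rewrite !fmap_id. Qed.

Lemma compF_comp (D E K : Category) (G : Functor E K) (H : Functor D E)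
    (A B C : D) (g : Hom B C) (f : Hom A B) :
  fmap G (fmap H (g ∘ f)) = fmap G (fmap H g) ∘ fmap G (fmap H f).
Proof. by rewrite !fmap_comp. Qed.

Definition compF (D E K : Category) (G : Functor E K) (H : Functor D E) :
    Functor D K :=
  @MkFunctor D K (fun A => G (H A)) (fun A B f => fmap G (fmap H f))
    (compF_id G H) (compF_comp G H).

Fixpoint powF (D : Category) (G : Functor D D) (m : nat) : Functor D D :=
  if m is m'.+1 then compF G (powF G m') else idF D.

Record NatTrans (D E : Category) (G H : Functor D E) := MkNatTrans {
  ntc :> forall A : D, Hom (G A) (H A);
  nt_nat : forall (A B : D) (f : Hom A B),
    ntc B ∘ fmap G f = fmap H f ∘ ntc A }.

Record NatIso (D E : Category) (G H : Functor D E) := MkNatIso {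
  ni_fwd :> NatTrans G H;
  ni_inv : NatTrans H G;
  ni_fwdK : forall A, ni_inv A ∘ ni_fwd A = idm (G A);
  ni_invK : forall A, ni_fwd A ∘ ni_inv A = idm (H A) }.

Definition ni_sym (D E : Category) (G H : Functor D E) (a : NatIso G H) :
    NatIso H G :=
  @MkNatIso D E H G (ni_inv a) a (@ni_invK _ _ _ _ a) (@ni_fwdK _ _ _ _ a).

(** [(Q, b, pi)] is the [I]-fold pullback power of [p : E -> B], i.e. the
    [I]-fold product of [p] in the slice over [B]; the structure map [b] is
    needed because [I] may be empty. *)
Definition is_fibre_power (D : Category) (I : Type) (E B Q : D) (p : Hom E B)
    (b : Hom Q B) (pi : I -> Hom Q E) : Prop :=
  (forall i, p ∘ pi i = b) /\
  forall (Z : D) (z : Hom Z B) (u : I -> Hom Z E), (forall i, p ∘ u i = z) ->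
    exists! w : Hom Z Q, b ∘ w = z /\ forall i, pi i ∘ w = u i.

Definition two (S : Type) (a b : S) (i : 'I_2) : S :=
  if val i == 0 then a else b.

Definition is_equalizer (D : Category) (Q A B : D) (e : Hom Q A)
    (f g : Hom A B) : Prop :=
  f ∘ e = g ∘ e /\
  forall (Z : D) (u : Hom Z A), f ∘ u = g ∘ u -> exists! w : Hom Z Q, e ∘ w = u.

(** [w] is the pairing [<u, v>]. It is only used where [pi1] and [pi2] are the
    projections of a pullback, so that [w] is determined by [u] and [v]. *)
Definition is_pair (D : Category) (Z Q E E' : D) (pi1 : Hom Q E)
    (pi2 : Hom Q E') (u : Hom Z E) (v : Hom Z E') (w : Hom Z Q) : Prop :=
  pi1 ∘ w = u /\ pi2 ∘ w = v.

(** [(p, add, zero)] is a commutative monoid in the slice over [B], where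
    [(E2, pi1, pi2)] is the product of [p] with itself in this slice. *)
Record is_comm_monoid_over (D : Category) (E B E2 : D) (p : Hom E B)
    (pi1 pi2 : Hom E2 E) (add : Hom E2 E) (zero : Hom B E) : Prop := {
  cmo_zero_over : p ∘ zero = idm B;
  cmo_add_over : p ∘ add = p ∘ pi1;
  cmo_add0l : exists w : Hom E E2,
    is_pair pi1 pi2 (zero ∘ p) (idm E) w /\ add ∘ w = idm E;
  cmo_add0r : exists w : Hom E E2,
    is_pair pi1 pi2 (idm E) (zero ∘ p) w /\ add ∘ w = idm E;
  cmo_addC : exists w : Hom E2 E2, is_pair pi1 pi2 pi2 pi1 w /\ add ∘ w = add;
  cmo_addA : forall (E3 : D) (b : Hom E3 B) (q : 'I_3 -> Hom E3 E),
    is_fibre_power p b q ->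
    exists w01 w12 wl wr : Hom E3 E2,
      [/\ is_pair pi1 pi2 (q (inord 0)) (q (inord 1)) w01,
          is_pair pi1 pi2 (q (inord 1)) (q (inord 2)) w12,
          is_pair pi1 pi2 (add ∘ w01) (q (inord 2)) wl,
          is_pair pi1 pi2 (q (inord 0)) (add ∘ w12) wr &
          add ∘ wl = add ∘ wr] }.

(** The addition has a domain only once a pullback [T_2 A] has been chosen for
    every [A], whence the fields [tT2], [tpi1] and [tpi2]. *)
Record TangentData (D : Category) := MkTangentData {
  tT : Functor D D;
  tp : NatTrans tT (idF D);
  tzero : NatTrans (idF D) tT;
  tT2 : Functor D D;
  tpi1 : NatTrans tT2 tT;
  tpi2 : NatTrans tT2 tT;
  tadd : NatTrans tT2 tT;
  tl : NatTrans tT (compF tT tT);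
  tc : NatTrans (compF tT tT) (compF tT tT) }.

Record is_tangent_structure (D : Category) (S : TangentData D) : Prop := {
  ts_T2 : forall A,
    is_fibre_power (tp S A) (tp S A ∘ tpi1 S A) (two (tpi1 S A) (tpi2 S A));
  ts_Tn : forall (A : D) (n : nat),
    exists (Q : D) (b : Hom Q A) (pi : 'I_n -> Hom Q (tT S A)),
      is_fibre_power (tp S A) b pi;
  ts_Tn_pres : forall (A : D) (n : nat) (Q : D) (b : Hom Q A)
      (pi : 'I_n -> Hom Q (tT S A)), is_fibre_power (tp S A) b pi ->
    forall m, is_fibre_power (fmap (powF (tT S) m) (tp S A))
      (fmap (powF (tT S) m) b) (fun i => fmap (powF (tT S) m) (pi i));
  ts_monoid : forall A,
    is_comm_monoid_over (tp S A) (tpi1 S A) (tpi2 S A) (tadd S A) (tzero S A);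
  ts_l_p : forall A, fmap (tT S) (tp S A) ∘ tl S A = tzero S A ∘ tp S A;
  ts_l_add : forall A, exists w : Hom (tT2 S A) (tT S (tT2 S A)),
    is_pair (fmap (tT S) (tpi1 S A)) (fmap (tT S) (tpi2 S A))
      (tl S A ∘ tpi1 S A) (tl S A ∘ tpi2 S A) w /\
    tl S A ∘ tadd S A = fmap (tT S) (tadd S A) ∘ w;
  ts_l_zero : forall A,
    tl S A ∘ tzero S A = fmap (tT S) (tzero S A) ∘ tzero S A;
  ts_c_p : forall A, tp S (tT S A) ∘ tc S A = fmap (tT S) (tp S A);
  ts_c_add : forall A, exists w : Hom (tT S (tT2 S A)) (tT2 S (tT S A)),
    is_pair (tpi1 S (tT S A)) (tpi2 S (tT S A))
      (tc S A ∘ fmap (tT S) (tpi1 S A)) (tc S A ∘ fmap (tT S) (tpi2 S A)) w /\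
    tc S A ∘ fmap (tT S) (tadd S A) = tadd S (tT S A) ∘ w;
  ts_c_zero : forall A, tc S A ∘ fmap (tT S) (tzero S A) = tzero S (tT S A);
  ts_cc : forall A, tc S A ∘ tc S A = idm (tT S (tT S A));
  ts_cl : forall A, tc S A ∘ tl S A = tl S A;
  ts_ll : forall A, fmap (tT S) (tl S A) ∘ tl S A = tl S (tT S A) ∘ tl S A;
  ts_ccc : forall A,
    tc S (tT S A) ∘ fmap (tT S) (tc S A) ∘ tc S (tT S A) =
    fmap (tT S) (tc S A) ∘ tc S (tT S A) ∘ fmap (tT S) (tc S A);
  ts_ccl : forall A,
    tc S (tT S A) ∘ fmap (tT S) (tc S A) ∘ tl S (tT S A) =
    fmap (tT S) (tl S A) ∘ tc S A;
  ts_univ : forall A, exists w : Hom (tT2 S A) (tT S (tT2 S A)),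
    is_pair (fmap (tT S) (tpi1 S A)) (fmap (tT S) (tpi2 S A))
      (tl S A ∘ tpi1 S A) (tzero S (tT S A) ∘ tpi2 S A) w /\
    is_equalizer (fmap (tT S) (tadd S A) ∘ w)
      (fmap (tT S) (tp S A)) (tzero S A ∘ tp S A ∘ tp S (tT S A)) }.

Record TangentStructure (D : Category) := MkTangentStructure {
  ts_data :> TangentData D;
  ts_laws : is_tangent_structure ts_data }.

Record is_tangent_morphism (D E : Category) (T : TangentStructure D)
    (S : TangentStructure E) (H : Functor D E)
    (a : NatTrans (compF H (tT T)) (compF (tT S) H)) : Prop := {
  tm_p : forall A, tp S (H A) ∘ a A = fmap H (tp T A);
  tm_zero : forall A, a A ∘ fmap H (tzero T A) = tzero S (H A);
  (* [a2] is the morphism [H (T_2 A) -> S_2 (H A)] induced by [a] *)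
  tm_add : forall A, exists a2 : Hom (H (tT2 T A)) (tT2 S (H A)),
    is_pair (tpi1 S (H A)) (tpi2 S (H A))
      (a A ∘ fmap H (tpi1 T A)) (a A ∘ fmap H (tpi2 T A)) a2 /\
    a A ∘ fmap H (tadd T A) = tadd S (H A) ∘ a2;
  tm_l : forall A,
    tl S (H A) ∘ a A = fmap (tT S) (a A) ∘ a (tT T A) ∘ fmap H (tl T A);
  tm_c : forall A,
    tc S (H A) ∘ (fmap (tT S) (a A) ∘ a (tT T A)) =
    fmap (tT S) (a A) ∘ a (tT T A) ∘ fmap H (tc T A) }.

(** Invertibility of the 2-cell is part of the type of [a]. *)
Record is_strong_tangent_morphism (D E : Category) (T : TangentStructure D)
    (S : TangentStructure E) (H : Functor D E)
    (a : NatIso (compF H (tT T)) (compF (tT S) H)) : Prop := {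
  stm_morphism : is_tangent_morphism a;
  stm_pullbacks : forall (A : D) (n : nat) (Q : D) (b : Hom Q A)
      (pi : 'I_n -> Hom Q (tT T A)), is_fibre_power (tp T A) b pi ->
    is_fibre_power (fmap H (tp T A)) (fmap H b) (fun i => fmap H (pi i));
  stm_equalizers : forall (A Q : D) (e : Hom Q (tT T (tT T A))),
    is_equalizer e (fmap (tT T) (tp T A))
      (tzero T A ∘ tp T A ∘ tp T (tT T A)) ->
    is_equalizer (fmap H e) (fmap H (fmap (tT T) (tp T A)))
      (fmap H (tzero T A ∘ tp T A ∘ tp T (tT T A))) }.

Section UnitEquations.

Context (C : Category) (F : C -> Category).
Context (Fm : forall X Y : C, Hom X Y -> Functor (F Y) (F X)).
Context (Fid : forall X : C, Fm (idm X) = idF (F X)).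

Definition unitl_eq (X Y : C) (f : Hom X Y) (A : F Y) :
    Fm (idm X) (Fm f A) = Fm (f ∘ idm X) A :=
  etrans (congr1 (fun G : Functor _ _ => G (Fm f A)) (Fid X))
         (congr1 (fun h => Fm h A) (esym (comp_idr f))).

Definition unitr_eq (X Y : C) (f : Hom X Y) (A : F Y) :
    Fm f (Fm (idm Y) A) = Fm (idm Y ∘ f) A :=
  etrans (congr1 (fun G : Functor _ _ => Fm f (G A)) (Fid Y))
         (congr1 (fun h => Fm h A) (esym (comp_idl f))).

Definition assoc_eq (X Y Z W : C) (f : Hom X Y) (g : Hom Y Z) (h : Hom Z W)
    (A : F W) : Fm (h ∘ (g ∘ f)) A = Fm ((h ∘ g) ∘ f) A :=
  congr1 (fun k => Fm k A) (compA h g f).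

Definition unit_nat_eq (X : C) (G : Functor (F X) (F X)) (A : F X) :
    G (Fm (idm X) A) = Fm (idm X) (G A) :=
  etrans (congr1 (fun K : Functor _ _ => G (K A)) (Fid X))
         (congr1 (fun K : Functor _ _ => K (G A)) (esym (Fid X))).

End UnitEquations.

(** A normalized pseudofunctor [C^op -> Cat], with [pf_id] as an equality of
    functors. The coherence laws say that the compositors at identities are identities
    and that the two morphisms [F(f)F(g)F(h) => F(hgf)] agree; [eqhom] only
    identifies values of [F] at provably equal morphisms of [C]. *)
Record PseudoFunctor (C : Category) := MkPseudoFunctor {
  pf_ob :> C -> Category;
  pf_map : forall X Y : C, Hom X Y -> Functor (pf_ob Y) (pf_ob X);
  pf_id : forall X : C, pf_map (idm X) = idF (pf_ob X);
  pf_phi : forall (X Y Z : C) (f : Hom X Y) (g : Hom Y Z),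
    NatIso (compF (pf_map f) (pf_map g)) (pf_map (g ∘ f));
  pf_unitl : forall (X Y : C) (f : Hom X Y) (A : pf_ob Y),
    pf_phi (idm X) f A = eqhom (unitl_eq pf_id f A);
  pf_unitr : forall (X Y : C) (f : Hom X Y) (A : pf_ob Y),
    pf_phi f (idm Y) A = eqhom (unitr_eq pf_id f A);
  pf_assoc : forall (X Y Z W : C) (f : Hom X Y) (g : Hom Y Z) (h : Hom Z W)
      (A : pf_ob W),
    pf_phi f (h ∘ g) A ∘ fmap (pf_map f) (pf_phi g h A) =
    eqhom (assoc_eq pf_map f g h A) ∘
      (pf_phi (g ∘ f) h A ∘ pf_phi f g (pf_map h A)) }.

Arguments pf_map {C} F {X Y} _ : rename.
Arguments pf_phi {C} F {X Y Z} f g : rename.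

(** Functors [N X] and natural isomorphisms [n f] form a pseudonatural
    endotransformation of [F]. *)
Record is_pseudonatural (C : Category) (F : PseudoFunctor C)
    (N : forall X : C, Functor (F X) (F X))
    (n : forall (X Y : C) (f : Hom X Y),
       NatIso (compF (N X) (pf_map F f)) (compF (pf_map F f) (N Y))) : Prop := {
  psn_id : forall (X : C) (A : F X),
    n X X (idm X) A = eqhom (unit_nat_eq (@pf_id C F) (N X) A);
  psn_comp : forall (X Y Z : C) (f : Hom X Y) (g : Hom Y Z) (A : F Z),
    n X Z (g ∘ f) A ∘ fmap (N X) (pf_phi F f g A) =
    pf_phi F f g (N Z A) ∘ fmap (pf_map F f) (n Y Z g A) ∘
      n X Y f (pf_map F g A) }.

Record TangentIndexing (C : Category) (F : PseudoFunctor C) :=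
  MkTangentIndexing {
  ti_ts : forall X : C, TangentStructure (F X);
  ti_iso : forall (X Y : C) (f : Hom X Y),
    NatIso (compF (pf_map F f) (tT (ti_ts Y))) (compF (tT (ti_ts X)) (pf_map F f));
  ti_strong : forall (X Y : C) (f : Hom X Y),
    is_strong_tangent_morphism (ti_iso f);
  ti_pseudonat : @is_pseudonatural C F (fun X => tT (ti_ts X))
    (fun X Y f => ni_sym (ti_iso f)) }.

Arguments ti_ts {C F} I X : rename.
Arguments ti_iso {C F} I {X Y} f : rename.

Section PseudoCones.

Context (C : Category) (F : PseudoFunctor C).

Record PCObj := MkPCObj {
  pco :> forall X : C, F X;
  pctau : forall (X Y : C) (f : Hom X Y), Hom (pf_map F f (pco Y)) (pco X);
  pctau_iso : forall (X Y : C) (f : Hom X Y), is_iso (pctau f);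
  pctau_comp : forall (X Y Z : C) (f : Hom X Y) (g : Hom Y Z),
    pctau (g ∘ f) ∘ pf_phi F f g (pco Z) =
    pctau f ∘ fmap (pf_map F f) (pctau g) }.

Record PCHom (A B : PCObj) := MkPCHom {
  pcm :> forall X : C, Hom (A X) (B X);
  pcm_nat : forall (X Y : C) (f : Hom X Y),
    pctau B f ∘ fmap (pf_map F f) (pcm Y) = pcm X ∘ pctau A f }.

Lemma pchom_eq (A B : PCObj) (r s : PCHom A B) : (forall X, r X = s X) -> r = s.
Proof.
case: r s => [r hr] [s hs] /= e.
have e' : r = s by apply: functional_extensionality_dep.
by subst s; rewrite (proof_irrelevance _ hr hs).
Qed.

Lemma pcid_nat (A : PCObj) (X Y : C) (f : Hom X Y) :
  pctau A f ∘ fmap (pf_map F f) (idm (A Y)) = idm (A X) ∘ pctau A f.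
Proof. by rewrite fmap_id comp_idl comp_idr. Qed.

Definition pcid (A : PCObj) : PCHom A A := MkPCHom (@pcid_nat A).

Lemma pccomp_nat (A B K : PCObj) (s : PCHom B K) (r : PCHom A B)
    (X Y : C) (f : Hom X Y) :
  pctau K f ∘ fmap (pf_map F f) (s Y ∘ r Y) = (s X ∘ r X) ∘ pctau A f.
Proof. by rewrite fmap_comp compA pcm_nat -!compA pcm_nat. Qed.

Definition pccomp (A B K : PCObj) (s : PCHom B K) (r : PCHom A B) : PCHom A K :=
  MkPCHom (pccomp_nat s r).

Lemma pccomp_idl (A B : PCObj) (r : PCHom A B) : pccomp (pcid B) r = r.
Proof. by apply: pchom_eq => X; apply: comp_idl. Qed.

Lemma pccomp_idr (A B : PCObj) (r : PCHom A B) : pccomp r (pcid A) = r.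
Proof. by apply: pchom_eq => X; apply: comp_idr. Qed.

Lemma pccompA (A B K L : PCObj) (t : PCHom K L) (s : PCHom B K)
    (r : PCHom A B) : pccomp t (pccomp s r) = pccomp (pccomp t s) r.
Proof. by apply: pchom_eq => X; apply: compA. Qed.

Definition PC : Category :=
  @MkCategory PCObj PCHom pcid pccomp pccomp_idl pccomp_idr pccompA.

End PseudoCones.

Lemma is_iso_comp (D : Category) (A B K : D) (g : Hom B K) (f : Hom A B) :
  is_iso g -> is_iso f -> is_iso (g ∘ f).
Proof.
move=> [g' [g'g gg']] [f' [f'f ff']]; exists (f' ∘ g'); split.
  by rewrite -compA (compA g') g'g comp_idl.
by rewrite -compA (compA f) ff' comp_idl.
Qed.

Lemma is_iso_fmap (D E : Category) (G : Functor D E) (A B : D) (f : Hom A B) :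
  is_iso f -> is_iso (fmap G f).
Proof.
by move=> [f' [f'f ff']]; exists (fmap G f'); rewrite -!fmap_comp f'f ff' !fmap_id.
Qed.

Lemma is_iso_ni (D E : Category) (G H : Functor D E) (a : NatIso G H) (A : D) :
  is_iso (a A).
Proof. by exists (ni_inv a A); split; [apply: ni_fwdK | apply: ni_invK]. Qed.

Lemma inv_square (D : Category) (K L M N P : D) (t : Hom P N) (t' : Hom N P)
    (x : Hom M N) (y : Hom K P) (s : Hom L M) (s' : Hom M L) (r : Hom K L)
    (r' : Hom L K) :
  t ∘ t' = idm N -> s' ∘ s = idm L -> r' ∘ r = idm K ->
  t' ∘ x = y ∘ r' ∘ s' -> t ∘ y = x ∘ s ∘ r.
Proof.
move=> tK sK rK E; rewrite -[RHS]comp_idl -tK -!compA (compA t') E.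
by rewrite -!compA (compA s') sK comp_idl rK comp_idr.
Qed.

Section TangentBundle.

Context (C : Category) (F : PseudoFunctor C) (I : TangentIndexing F).

Definition pcT_tau (A : PC F) (X Y : C) (f : Hom X Y) :
    Hom (pf_map F f (tT (ti_ts I Y) (A Y))) (tT (ti_ts I X) (A X)) :=
  fmap (tT (ti_ts I X)) (pctau A f) ∘ ti_iso I f (A Y).

Lemma pcT_tau_iso (A : PC F) (X Y : C) (f : Hom X Y) : is_iso (pcT_tau A f).
Proof.
apply: is_iso_comp; last exact: (is_iso_ni (ti_iso I f)).
by apply: is_iso_fmap; apply: pctau_iso.
Qed.

Lemma ti_iso_comp (X Y Z : C) (f : Hom X Y) (g : Hom Y Z) (A : F Z) :
  ti_iso I (g ∘ f) A ∘ pf_phi F f g (tT (ti_ts I Z) A) =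
  fmap (tT (ti_ts I X)) (pf_phi F f g A) ∘ ti_iso I f (pf_map F g A)
    ∘ fmap (pf_map F f) (ti_iso I g A).
Proof.
apply: (inv_square (t' := ni_inv (ti_iso I (g ∘ f)) A)
  (s' := ni_inv (ti_iso I f) (pf_map F g A))
  (r' := fmap (pf_map F f) (ni_inv (ti_iso I g) A))).
- exact: (ni_invK (ti_iso I (g ∘ f))).
- exact: (ni_fwdK (ti_iso I f)).
- by rewrite -fmap_comp (ni_fwdK (ti_iso I g)) fmap_id.
- exact: (psn_comp (ti_pseudonat I) f g A).
Qed.

Lemma pcT_tau_comp (A : PC F) (X Y Z : C) (f : Hom X Y) (g : Hom Y Z) :
  pcT_tau A (g ∘ f) ∘ pf_phi F f g (tT (ti_ts I Z) (A Z)) =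
  pcT_tau A f ∘ fmap (pf_map F f) (pcT_tau A g).
Proof.
rewrite /pcT_tau -compA ti_iso_comp !compA -fmap_comp pctau_comp.
rewrite !fmap_comp -!compA; congr (_ ∘ _); rewrite !compA; congr (_ ∘ _).
exact/esym/(nt_nat (ti_iso I f)).
Qed.

Definition pcT_ob (A : PC F) : PC F :=
  @MkPCObj C F (fun X => tT (ti_ts I X) (A X)) (@pcT_tau A)
    (@pcT_tau_iso A) (@pcT_tau_comp A).

Lemma pcT_nat (A B : PC F) (r : Hom A B) (X Y : C) (f : Hom X Y) :
  pctau (pcT_ob B) f ∘ fmap (pf_map F f) (fmap (tT (ti_ts I Y)) (pcm r Y)) =
  fmap (tT (ti_ts I X)) (pcm r X) ∘ pctau (pcT_ob A) f.
Proof.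
rewrite /= /pcT_tau -compA [X in _ ∘ X](nt_nat (ti_iso I f)) /= !compA.
by rewrite -!fmap_comp pcm_nat.
Qed.

Definition pcT_map (A B : PC F) (r : Hom A B) : Hom (pcT_ob A) (pcT_ob B) :=
  @MkPCHom C F (pcT_ob A) (pcT_ob B)
    (fun X => fmap (tT (ti_ts I X)) (pcm r X)) (pcT_nat r).

Lemma pcT_map_id (A : PC F) : pcT_map (idm A) = idm (pcT_ob A).
Proof. by apply: pchom_eq => X; apply: fmap_id. Qed.

Lemma pcT_map_comp (A B K : PC F) (s : Hom B K) (r : Hom A B) :
  pcT_map (s ∘ r) = pcT_map s ∘ pcT_map r.
Proof. by apply: pchom_eq => X; apply: fmap_comp. Qed.

Definition pcT : Functor (PC F) (PC F) := MkFunctor pcT_map_id pcT_map_comp.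

Lemma two_forall (S : Type) (P : S -> Prop) (a b : S) :
  P a -> P b -> forall i : 'I_2, P (two a b i).
Proof. by rewrite /two => Pa Pb i; case: ifP. Qed.

Lemma two0 (S : Type) (a b : S) : two a b (@Ordinal 2 0 isT) = a.
Proof. by []. Qed.

Lemma two1 (S : Type) (a b : S) : two a b (@Ordinal 2 1 isT) = b.
Proof. by []. Qed.

Lemma two_fmap (D E : Category) (G : Functor D E) (Q B : D) (a b : Hom Q B) :
  (fun i => fmap G (two a b i)) = two (fmap G a) (fmap G b).
Proof. by apply: functional_extensionality => i; rewrite /two; case: ifP. Qed.

Lemma fibre_power2_lift (D : Category) (E B Q : D) (p : Hom E B) (b : Hom Q B)
    (pi1 pi2 : Hom Q E) : is_fibre_power p b (two pi1 pi2) ->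
  forall (Z : D) (u v : Hom Z E), p ∘ u = p ∘ v ->
  exists w : Hom Z Q, is_pair pi1 pi2 u v w.
Proof.
move=> [_ univ] Z u v e.
have [|w [[_ h] _]] := univ Z (p ∘ u) (two u v).
  by apply: (two_forall (P := fun x => p ∘ x = p ∘ u)).
by exists w; split; [apply: (h (@Ordinal 2 0 isT)) | apply: (h (@Ordinal 2 1 isT))].
Qed.

Lemma fibre_power2_uniq (D : Category) (E B Q : D) (p : Hom E B) (b : Hom Q B)
    (pi1 pi2 : Hom Q E) : is_fibre_power p b (two pi1 pi2) ->
  forall (Z : D) (w w' : Hom Z Q),
    pi1 ∘ w = pi1 ∘ w' -> pi2 ∘ w = pi2 ∘ w' -> w = w'.
Proof.
move=> [e univ] Z w w' e1 e2.
have b1 : p ∘ pi1 = b := e (@Ordinal 2 0 isT).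
have [|x [_ h]] := univ Z (b ∘ w) (fun i => two pi1 pi2 i ∘ w).
  by move=> i; rewrite compA e.
rewrite -(h w) // -(h w') //; split; first by rewrite -b1 -!compA e1.
by move=> i; rewrite /two; case: ifP.
Qed.

Lemma pf_T2 (X Y : C) (f : Hom X Y) (A : F Y) :
  let S := ti_ts I Y in
  is_fibre_power (fmap (pf_map F f) (tp S A))
    (fmap (pf_map F f) (tp S A ∘ tpi1 S A))
    (two (fmap (pf_map F f) (tpi1 S A)) (fmap (pf_map F f) (tpi2 S A))).
Proof.
move=> S; rewrite -two_fmap.
exact: (stm_pullbacks (ti_strong I f) (ts_T2 (ts_laws S) A)).
Qed.

Lemma tpi_p (D : Category) (S : TangentStructure D) (A : D) :
  tp S A ∘ tpi1 S A = tp S A ∘ tpi2 S A.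
Proof. by have [e _] := ts_T2 (ts_laws S) A; rewrite -(e (@Ordinal 2 1 isT)). Qed.

Lemma pcT_tau_p (A : PC F) (X Y : C) (f : Hom X Y) :
  tp (ti_ts I X) (A X) ∘ pcT_tau A f =
  pctau A f ∘ fmap (pf_map F f) (tp (ti_ts I Y) (A Y)).
Proof.
rewrite compA [X in X ∘ _](nt_nat (tp (ti_ts I X))) /= -compA.
by rewrite (tm_p (stm_morphism (ti_strong I f))).
Qed.

Lemma pcT2_tau_ex (A : PC F) (X Y : C) (f : Hom X Y) :
  exists w : Hom (pf_map F f (tT2 (ti_ts I Y) (A Y))) (tT2 (ti_ts I X) (A X)),
    is_pair (tpi1 (ti_ts I X) (A X)) (tpi2 (ti_ts I X) (A X))
      (pcT_tau A f ∘ fmap (pf_map F f) (tpi1 (ti_ts I Y) (A Y)))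
      (pcT_tau A f ∘ fmap (pf_map F f) (tpi2 (ti_ts I Y) (A Y))) w.
Proof.
apply: (fibre_power2_lift (ts_T2 (ts_laws (ti_ts I X)) (A X))).
by rewrite [LHS]compA [RHS]compA pcT_tau_p -!compA -!fmap_comp tpi_p.
Qed.

(** The transition isomorphism of the fibrewise [T_2 A] is the morphism induced
    on pullbacks by those of [T A]. *)
Definition pcT2_tau (A : PC F) (X Y : C) (f : Hom X Y) :
    Hom (pf_map F f (tT2 (ti_ts I Y) (A Y))) (tT2 (ti_ts I X) (A X)) :=
  proj1_sig (constructive_indefinite_description _ (pcT2_tau_ex A f)).

Lemma pcT2_tau1 (A : PC F) (X Y : C) (f : Hom X Y) :
  tpi1 (ti_ts I X) (A X) ∘ pcT2_tau A f =
  pcT_tau A f ∘ fmap (pf_map F f) (tpi1 (ti_ts I Y) (A Y)).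
Proof. by rewrite /pcT2_tau; case: constructive_indefinite_description => w []. Qed.

Lemma pcT2_tau2 (A : PC F) (X Y : C) (f : Hom X Y) :
  tpi2 (ti_ts I X) (A X) ∘ pcT2_tau A f =
  pcT_tau A f ∘ fmap (pf_map F f) (tpi2 (ti_ts I Y) (A Y)).
Proof. by rewrite /pcT2_tau; case: constructive_indefinite_description => w []. Qed.

Lemma pcT2_tau_iso (A : PC F) (X Y : C) (f : Hom X Y) : is_iso (pcT2_tau A f).
Proof.
have [t [tK Kt]] := pcT_tau_iso A f.
have [s [sK Ks]] := pctau_iso A f.
have pt : fmap (pf_map F f) (tp (ti_ts I Y) (A Y)) ∘ t = s ∘ tp (ti_ts I X) (A X).
  rewrite -[LHS]comp_idl -sK -compA (compA (pctau A f)) -pcT_tau_p.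
  by rewrite -(compA (tp _ _)) Kt comp_idr.
have [|w [w1 w2]] := fibre_power2_lift (pf_T2 f (A Y))
  (u := t ∘ tpi1 (ti_ts I X) (A X)) (v := t ∘ tpi2 (ti_ts I X) (A X)).
  by rewrite !compA pt -!compA tpi_p.
exists w; split.
  by apply: (fibre_power2_uniq (pf_T2 f (A Y)));
    rewrite compA ?w1 ?w2 -compA ?pcT2_tau1 ?pcT2_tau2 compA tK comp_idl comp_idr.
by apply: (fibre_power2_uniq (ts_T2 (ts_laws (ti_ts I X)) (A X)));
  rewrite compA ?pcT2_tau1 ?pcT2_tau2 -compA ?w1 ?w2 compA Kt comp_idl comp_idr.
Qed.

Lemma pcT2_tau_comp (A : PC F) (X Y Z : C) (f : Hom X Y) (g : Hom Y Z) :
  pcT2_tau A (g ∘ f) ∘ pf_phi F f g (tT2 (ti_ts I Z) (A Z)) =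
  pcT2_tau A f ∘ fmap (pf_map F f) (pcT2_tau A g).
Proof.
have N := nt_nat (pf_phi F f g); rewrite /= in N.
apply: (fibre_power2_uniq (ts_T2 (ts_laws (ti_ts I X)) (A X))).
- rewrite [LHS]compA pcT2_tau1 -[LHS]compA -N [LHS]compA pcT_tau_comp.
  by rewrite [RHS]compA pcT2_tau1 -[RHS]compA -(fmap_comp (pf_map F f)) pcT2_tau1 fmap_comp compA.
- rewrite [LHS]compA pcT2_tau2 -[LHS]compA -N [LHS]compA pcT_tau_comp.
  by rewrite [RHS]compA pcT2_tau2 -[RHS]compA -(fmap_comp (pf_map F f)) pcT2_tau2 fmap_comp compA.
Qed.

Definition pcT2_ob (A : PC F) : PC F :=
  @MkPCObj C F (fun X => tT2 (ti_ts I X) (A X)) (@pcT2_tau A)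
    (@pcT2_tau_iso A) (@pcT2_tau_comp A).

Lemma pcT2_nat (A B : PC F) (r : Hom A B) (X Y : C) (f : Hom X Y) :
  pctau (pcT2_ob B) f ∘ fmap (pf_map F f) (fmap (tT2 (ti_ts I Y)) (pcm r Y)) =
  fmap (tT2 (ti_ts I X)) (pcm r X) ∘ pctau (pcT2_ob A) f.
Proof.
have N := pcT_nat r f; rewrite /= in N.
apply: (fibre_power2_uniq (ts_T2 (ts_laws (ti_ts I X)) (B X))) => /=.
- rewrite [LHS]compA pcT2_tau1 -[LHS]compA -(fmap_comp (pf_map F f)) nt_nat fmap_comp [LHS]compA N.
  by rewrite [RHS]compA nt_nat -[RHS]compA pcT2_tau1 compA.
- rewrite [LHS]compA pcT2_tau2 -[LHS]compA -(fmap_comp (pf_map F f)) nt_nat fmap_comp [LHS]compA N.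
  by rewrite [RHS]compA nt_nat -[RHS]compA pcT2_tau2 compA.
Qed.

Definition pcT2_map (A B : PC F) (r : Hom A B) : Hom (pcT2_ob A) (pcT2_ob B) :=
  @MkPCHom C F (pcT2_ob A) (pcT2_ob B)
    (fun X => fmap (tT2 (ti_ts I X)) (pcm r X)) (pcT2_nat r).

Lemma pcT2_map_id (A : PC F) : pcT2_map (idm A) = idm (pcT2_ob A).
Proof. by apply: pchom_eq => X; apply: fmap_id. Qed.

Lemma pcT2_map_comp (A B K : PC F) (s : Hom B K) (r : Hom A B) :
  pcT2_map (s ∘ r) = pcT2_map s ∘ pcT2_map r.
Proof. by apply: pchom_eq => X; apply: fmap_comp. Qed.

Definition pcT2 : Functor (PC F) (PC F) := MkFunctor pcT2_map_id pcT2_map_comp.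

End TangentBundle.

(* Main.v *)
(** Everything is computed fibrewise. The only point that is not immediate is
    that a pullback power in [PC F] given by its universal property is fibrewise
    a pullback power: since the reindexing functors preserve the fibrewise
    powers, these assemble into a power in [PC F], and by uniqueness every other
    power is isomorphic to that one, hence fibrewise isomorphic to it. *)

From mathcomp Require Import all_boot.
From Stdlib Require Import FunctionalExtensionality.
From Stdlib Require Import IndefiniteDescription.
Require Import Defs.

Set Implicit Arguments.
Unset Strict Implicit.
Unset Printing Implicit Defensive.

Local Open Scope cat_scope.

(** Universal properties in the fibres give mere existence, one object [X] at a time, whereas
    pseudocones and their morphisms are families of data; choice bridges the two. *)
Lemma exists_family (J : Type) (T : J -> Type) (P : forall j, T j -> Prop) :
  (forall j, exists x, P j x) -> exists g : forall j, T j, forall j, P j (g j).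
Proof.
move=> h; pose s j := constructive_indefinite_description _ (h j).
by exists (fun j => proj1_sig (s j)) => j; apply: proj2_sig.
Qed.

Lemma two_comp (S S' : Type) (g : S -> S') (a b : S) :
  (fun i => g (two a b i)) = two (g a) (g b).
Proof. by apply: functional_extensionality => i; rewrite /two; case: ifP. Qed.

(** * Pullback powers in an arbitrary category *)

Section FibrePowers.

Context (D : Category) (J : Type).
Implicit Types E B Q Z : D.

(** Agreement after [b] is a separate hypothesis because for empty [J] there is no projection from
    which it would follow. *)
Lemma fibre_power_uniq E B Q (p : Hom E B) (b : Hom Q B) (pi : J -> Hom Q E) :
  is_fibre_power p b pi ->
  forall Z (w w' : Hom Z Q), b ∘ w = b ∘ w' ->
    (forall i, pi i ∘ w = pi i ∘ w') -> w = w'.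
Proof.
move=> [e univ] Z w w' eb epi.
have [|x [_ h]] := univ Z (b ∘ w) (fun i => pi i ∘ w).
  by move=> i; rewrite compA e.
by rewrite -(h w) //; apply: h; split=> [|i].
Qed.

Lemma fibre_power_lift E B Q (p : Hom E B) (b : Hom Q B) (pi : J -> Hom Q E) :
  is_fibre_power p b pi ->
  forall Z (z : Hom Z B) (u : J -> Hom Z E), (forall i, p ∘ u i = z) ->
  exists w : Hom Z Q, b ∘ w = z /\ forall i, pi i ∘ w = u i.
Proof. by move=> [_ univ] Z z u e; have [w [h _]] := univ Z z u e; exists w. Qed.

Lemma fibre_power_unique_iso E B Q Q' (p : Hom E B) (b : Hom Q B)
    (pi : J -> Hom Q E) (b' : Hom Q' B) (pi' : J -> Hom Q' E) :
  is_fibre_power p b pi -> is_fibre_power p b' pi' ->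
  exists (w : Hom Q' Q) (w' : Hom Q Q'),
    [/\ w' ∘ w = idm Q', w ∘ w' = idm Q, b ∘ w = b' &
        forall i, pi i ∘ w = pi' i].
Proof.
move=> h h'.
have [w [bw piw]] := fibre_power_lift h h'.1.
have [w' [bw' piw']] := fibre_power_lift h' h.1.
exists w, w'; split=> //.
- apply: (fibre_power_uniq h'); first by rewrite compA bw' bw comp_idr.
  by move=> i; rewrite compA piw' piw comp_idr.
- apply: (fibre_power_uniq h); first by rewrite compA bw bw' comp_idr.
  by move=> i; rewrite compA piw piw' comp_idr.
Qed.

Lemma fibre_power_iso E B Q Q' (p : Hom E B) (b : Hom Q B) (pi : J -> Hom Q E)
    (w : Hom Q' Q) (w' : Hom Q Q') :
  w' ∘ w = idm Q' -> w ∘ w' = idm Q -> is_fibre_power p b pi ->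
  is_fibre_power p (b ∘ w) (fun i => pi i ∘ w).
Proof.
move=> wK Kw h; split=> [i|Z z u e]; first by rewrite compA h.1.
have [x [bx pix]] := fibre_power_lift h e.
exists (w' ∘ x); split.
  by split=> [|i]; rewrite -compA (compA w w') Kw comp_idl.
move=> y [by_ piy]; rewrite -[y]comp_idl -wK -compA; congr (_ ∘ _).
apply: (fibre_power_uniq h); first by rewrite compA bx by_.
by move=> i; rewrite compA pix piy.
Qed.

End FibrePowers.

(** * Limits in [PC F] computed fibrewise *)

Section PseudoConeLimits.

Context (C : Category) (F : PseudoFunctor C).
Implicit Types A B E Q Z : PC F.

Lemma pccompE A B E (s : Hom B E) (r : Hom A B) (X : C) :
  pcm (s ∘ r) X = pcm s X ∘ pcm r X.
Proof. by []. Qed.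

(** The mediating maps chosen in the fibres form a morphism of pseudocones: both sides of each
    transition square have the same composites with [b] and the projections over [X], so uniqueness
    in that fibre makes them equal. *)
Lemma pc_fibre_power (J : Type) E B Q (p : Hom E B) (b : Hom Q B)
    (pi : J -> Hom Q E) :
  (forall X, is_fibre_power (pcm p X) (pcm b X) (fun i => pcm (pi i) X)) ->
  is_fibre_power p b pi.
Proof.
move=> h; split=> [i|Z z u e]; first by apply: pchom_eq => X; apply: (h X).1.
have /exists_family[w hw] : forall X, exists w : Hom (Z X) (Q X),
    pcm b X ∘ w = pcm z X /\ forall i, pcm (pi i) X ∘ w = pcm (u i) X.
  by move=> X; apply: (fibre_power_lift (h X)) => i; rewrite -pccompE e.
have wN X Y (f : Hom X Y) :
    pctau Q f ∘ fmap (pf_map F f) (w Y) = w X ∘ pctau Z f.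
  apply: (fibre_power_uniq (h X)) => [|i].
    by rewrite !compA -(pcm_nat b) (hw X).1 -compA -fmap_comp (hw Y).1 pcm_nat.
  rewrite !compA -(pcm_nat (pi i)) (hw X).2 -compA -fmap_comp (hw Y).2.
  by rewrite pcm_nat.
exists (MkPCHom wN : Hom Z Q); split.
  by split=> [|i]; apply: pchom_eq => X /=; have [h1 h2] := hw X.
move=> w' [e1 e2]; apply: pchom_eq => X /=.
apply: (fibre_power_uniq (h X)) => [|i].
  by rewrite (hw X).1 -e1.
by rewrite (hw X).2 -e2.
Qed.

(** As for pullback powers; here it is monicity of each [pcm e X] that makes the mediating maps
    compatible with the transitions. *)
Lemma pc_equalizer Q A B (e : Hom Q A) (f g : Hom A B) :
  (forall X, is_equalizer (pcm e X) (pcm f X) (pcm g X)) -> is_equalizer e f g.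
Proof.
move=> h; split=> [|Z u eu]; first by apply: pchom_eq => X; apply: (h X).1.
have uniq X (K : F X) (w w' : Hom K (Q X)) :
    pcm e X ∘ w = pcm e X ∘ w' -> w = w'.
  move=> ew; have [|x [_ hx]] := (h X).2 K (pcm e X ∘ w).
    by rewrite !compA (h X).1.
  by rewrite -(hx w) // -(hx w').
have /exists_family[w hw] : forall X, exists w : Hom (Z X) (Q X),
    pcm e X ∘ w = pcm u X.
  move=> X; have [|w [ew _]] := (h X).2 _ (pcm u X); last by exists w.
  by rewrite -!pccompE eu.
have wN X Y (k : Hom X Y) :
    pctau Q k ∘ fmap (pf_map F k) (w Y) = w X ∘ pctau Z k.
  by apply: uniq; rewrite !compA -(pcm_nat e) hw -compA -fmap_comp hw pcm_nat.
exists (MkPCHom wN : Hom Z Q); split; first by apply: pchom_eq.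
by move=> w' ew; apply: pchom_eq => X; apply: uniq; rewrite hw -ew.
Qed.

(** The predicate [P] records whatever else a fibrewise axiom asserts about its pairing, so that it
    survives the passage to the glued morphism. Joint monicity of the projections forces the
    transition squares. *)
Lemma pc_pair Q E E' Z (pi1 : Hom Q E) (pi2 : Hom Q E') (u : Hom Z E)
    (v : Hom Z E') (P : forall X : C, Hom (Z X) (Q X) -> Prop) :
  (forall X (K : F X) (w w' : Hom K (Q X)),
     pcm pi1 X ∘ w = pcm pi1 X ∘ w' -> pcm pi2 X ∘ w = pcm pi2 X ∘ w' ->
     w = w') ->
  (forall X, exists w : Hom (Z X) (Q X),
     is_pair (pcm pi1 X) (pcm pi2 X) (pcm u X) (pcm v X) w /\ P X w) ->
  exists w : Hom Z Q, is_pair pi1 pi2 u v w /\ forall X, P X (pcm w X).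
Proof.
move=> uniq /exists_family[w hw].
have wN X Y (f : Hom X Y) :
    pctau Q f ∘ fmap (pf_map F f) (w Y) = w X ∘ pctau Z f.
  have [[x1 x2] _] := hw X; have [[y1 y2] _] := hw Y.
  apply: uniq.
    by rewrite !compA -(pcm_nat pi1) x1 -compA -fmap_comp y1 pcm_nat.
  by rewrite !compA -(pcm_nat pi2) x2 -compA -fmap_comp y2 pcm_nat.
exists (MkPCHom wN : Hom Z Q); split=> [|X]; last exact: (hw X).2.
by split; apply: pchom_eq => X /=; have [[]] := hw X.
Qed.

End PseudoConeLimits.

(** * The structure maps as morphisms of pseudocones *)

Section TangentPseudoCones.

Context (C : Category) (F : PseudoFunctor C) (I : TangentIndexing F).
Implicit Types A B : PC F.

Local Notation TT X := (ti_ts I X).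
Local Notation M f := (stm_morphism (ti_strong I f)).

(** In this and the next three squares, compatibility of [ti_iso I f] with a structure map handles
    the reindexing, and naturality of that structure map in the fibre over [X] moves it past
    [pctau A f]. *)
Lemma pcT_tau_zero A (X Y : C) (f : Hom X Y) :
  pcT_tau I A f ∘ fmap (pf_map F f) (tzero (TT Y) (A Y)) =
  tzero (TT X) (A X) ∘ pctau A f.
Proof.
by rewrite -compA (tm_zero (M f)) [RHS](nt_nat (tzero (TT X))).
Qed.

Lemma pcT_tau_add A (X Y : C) (f : Hom X Y) :
  pcT_tau I A f ∘ fmap (pf_map F f) (tadd (TT Y) (A Y)) =
  tadd (TT X) (A X) ∘ pcT2_tau I A f.
Proof.
have [a2 [[e1 e2] e]] := tm_add (M f) (A Y).
rewrite -compA e compA -(nt_nat (tadd (TT X))) -compA; congr (_ ∘ _).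
(* [pcT2_tau] is known only through its projections; they identify it with [a2] followed by the
   image of [pctau A f] under [tT2]. *)
apply: (fibre_power2_uniq (ts_T2 (ts_laws (TT X)) (A X))).
- by rewrite pcT2_tau1 compA nt_nat -compA e1 compA.
- by rewrite pcT2_tau2 compA nt_nat -compA e2 compA.
Qed.

Lemma pcT_tau_l A (X Y : C) (f : Hom X Y) :
  pcT_tau I (pcT I A) f ∘ fmap (pf_map F f) (tl (TT Y) (A Y)) =
  tl (TT X) (A X) ∘ pcT_tau I A f.
Proof.
rewrite [RHS]compA (nt_nat (tl (TT X))) -[RHS]compA (tm_l (M f)) !compA.
by rewrite /pcT_tau /= /pcT_tau fmap_comp.
Qed.

Lemma pcT_tau_c A (X Y : C) (f : Hom X Y) :
  pcT_tau I (pcT I A) f ∘ fmap (pf_map F f) (tc (TT Y) (A Y)) =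
  tc (TT X) (A X) ∘ pcT_tau I (pcT I A) f.
Proof.
rewrite /pcT_tau /= /pcT_tau fmap_comp -[in RHS]compA [RHS]compA.
by rewrite (nt_nat (tc (TT X))) -[RHS]compA (tm_c (M f)) !compA.
Qed.

(** This and the following transformations are transparent, so that their [X]-components reduce to
    the fibre structure maps and fibre axioms apply to them directly. *)
Definition pc_p : NatTrans (pcT I) (idF (PC F)).
Proof.
exists (fun A => @MkPCHom C F (pcT I A) A (fun X => tp (TT X) (A X))
  (fun X Y f => esym (pcT_tau_p I A f))).
by move=> A B r; apply: pchom_eq => X; apply: (nt_nat (tp (TT X))).
Defined.

Definition pc_zero : NatTrans (idF (PC F)) (pcT I).
Proof.
exists (fun A => @MkPCHom C F A (pcT I A) (fun X => tzero (TT X) (A X))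
  (fun X Y f => pcT_tau_zero A f)).
by move=> A B r; apply: pchom_eq => X; apply: (nt_nat (tzero (TT X))).
Defined.

Definition pc_pi1 : NatTrans (pcT2 I) (pcT I).
Proof.
exists (fun A => @MkPCHom C F (pcT2 I A) (pcT I A)
  (fun X => tpi1 (TT X) (A X)) (fun X Y f => esym (pcT2_tau1 I A f))).
by move=> A B r; apply: pchom_eq => X; apply: (nt_nat (tpi1 (TT X))).
Defined.

Definition pc_pi2 : NatTrans (pcT2 I) (pcT I).
Proof.
exists (fun A => @MkPCHom C F (pcT2 I A) (pcT I A)
  (fun X => tpi2 (TT X) (A X)) (fun X Y f => esym (pcT2_tau2 I A f))).
by move=> A B r; apply: pchom_eq => X; apply: (nt_nat (tpi2 (TT X))).
Defined.

Definition pc_add : NatTrans (pcT2 I) (pcT I).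
Proof.
exists (fun A => @MkPCHom C F (pcT2 I A) (pcT I A)
  (fun X => tadd (TT X) (A X)) (fun X Y f => pcT_tau_add A f)).
by move=> A B r; apply: pchom_eq => X; apply: (nt_nat (tadd (TT X))).
Defined.

Definition pc_l : NatTrans (pcT I) (compF (pcT I) (pcT I)).
Proof.
exists (fun A => @MkPCHom C F (pcT I A) (pcT I (pcT I A))
  (fun X => tl (TT X) (A X)) (fun X Y f => pcT_tau_l A f)).
by move=> A B r; apply: pchom_eq => X; apply: (nt_nat (tl (TT X))).
Defined.

Definition pc_c : NatTrans (compF (pcT I) (pcT I)) (compF (pcT I) (pcT I)).
Proof.
exists (fun A => @MkPCHom C F (pcT I (pcT I A)) (pcT I (pcT I A))
  (fun X => tc (TT X) (A X)) (fun X Y f => pcT_tau_c A f)).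
by move=> A B r; apply: pchom_eq => X; apply: (nt_nat (tc (TT X))).
Defined.

(** * Pullback powers of the projection in [PC F] *)

Lemma pcTn_exists A (n : nat) :
  exists (Q : PC F) (b : Hom Q A) (pi : 'I_n -> Hom Q (pcT I A)),
  forall X, is_fibre_power (tp (TT X) (A X)) (pcm b X) (fun i => pcm (pi i) X).
Proof.
have /exists_family[Q /exists_family[b /exists_family[pi h]]] :=
  fun X => ts_Tn (ts_laws (TT X)) (A X) n.
(* Strength of the reindexing functors enters here: [F(f)] sends the chosen power over [Y] to a
   power again. *)
have hf X Y (f : Hom X Y) := stm_pullbacks (ti_strong I f) (h Y).
have tau_ex X Y (f : Hom X Y) : exists w : Hom (pf_map F f (Q Y)) (Q X),
    b X ∘ w = pctau A f ∘ fmap (pf_map F f) (b Y) /\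
    forall i, pi X i ∘ w = pcT_tau I A f ∘ fmap (pf_map F f) (pi Y i).
  apply: (fibre_power_lift (h X)) => i.
  by rewrite compA pcT_tau_p -compA -fmap_comp (h Y).1.
pose tau X Y f := proj1_sig (constructive_indefinite_description _ (tau_ex X Y f)).
have tau_b X Y f : b X ∘ tau X Y f = pctau A f ∘ fmap (pf_map F f) (b Y).
  by rewrite /tau; case: constructive_indefinite_description => w [].
have tau_pi X Y f i :
    pi X i ∘ tau X Y f = pcT_tau I A f ∘ fmap (pf_map F f) (pi Y i).
  by rewrite /tau; case: constructive_indefinite_description => w [].
(* The inverse is the mediating map into the reindexed power, built from the inverses [s] and [t] of
   the transition maps of [A] and [pcT I A]. *)
have tau_iso X Y f : is_iso (tau X Y f).
  have [t [tK Kt]] := pcT_tau_iso I A f.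
  have [s [sK Ks]] := pctau_iso A f.
  have pt : fmap (pf_map F f) (tp (TT Y) (A Y)) ∘ t = s ∘ tp (TT X) (A X).
    rewrite -[LHS]comp_idl -sK -compA (compA (pctau A f)) -pcT_tau_p.
    by rewrite -(compA (tp _ _)) Kt comp_idr.
  have [|w [wb wpi]] := fibre_power_lift (hf X Y f) (z := s ∘ b X)
    (u := fun i => t ∘ pi X i).
    by move=> i; rewrite compA pt -compA (h X).1.
  exists w; split.
    apply: (fibre_power_uniq (hf X Y f)) => [|i]; rewrite compA comp_idr.
      by rewrite wb -compA tau_b compA sK comp_idl.
    by rewrite wpi -compA tau_pi compA tK comp_idl.
  apply: (fibre_power_uniq (h X)) => [|i]; rewrite compA comp_idr.
    by rewrite tau_b -compA wb compA Ks comp_idl.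
  by rewrite tau_pi -compA wpi compA Kt comp_idl.
have tau_comp X Y Z (f : Hom X Y) (g : Hom Y Z) :
    tau X Z (g ∘ f) ∘ pf_phi F f g (Q Z) =
    tau X Y f ∘ fmap (pf_map F f) (tau Y Z g).
  (* Tested against [b] and the projections, the cocycle law reduces, by naturality of the
     compositor, to those of [A] and [pcT I A]. *)
  have N := nt_nat (pf_phi F f g); rewrite /= in N.
  apply: (fibre_power_uniq (h X)) => [|i].
    rewrite compA tau_b -compA -N compA pctau_comp [RHS]compA tau_b.
    by rewrite -!compA -!(fmap_comp (pf_map F f)) tau_b.
  rewrite compA tau_pi -compA -N compA pcT_tau_comp [RHS]compA tau_pi.
  by rewrite -!compA -!(fmap_comp (pf_map F f)) tau_pi.
pose Q' : PC F := MkPCObj tau_iso tau_comp.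
exists Q', (@MkPCHom C F Q' A b (fun X Y f => esym (tau_b X Y f))).
exists (fun i => @MkPCHom C F Q' (pcT I A) (fun X => pi X i)
  (fun X Y f => esym (tau_pi X Y f i))).
exact: h.
Qed.

(** Preservation of powers and associativity of addition both quantify over every power in [PC F],
    not only over the one assembled from chosen fibre powers. *)
Lemma pcTn_pointwise A (n : nat) (Q : PC F) (b : Hom Q A)
    (pi : 'I_n -> Hom Q (pcT I A)) :
  is_fibre_power (pc_p A) b pi ->
  forall X, is_fibre_power (tp (TT X) (A X)) (pcm b X) (fun i => pcm (pi i) X).
Proof.
move=> h X; have [Q' [b' [pi' h']]] := pcTn_exists A n.
have hpc : is_fibre_power (pc_p A) b' pi' by apply: pc_fibre_power.
have [w [w' [wK Kw bw piw]]] := fibre_power_unique_iso hpc h.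
rewrite -bw (_ : (fun i => _) = fun i => pcm (pi' i) X ∘ pcm w X); last first.
  by apply: functional_extensionality => i; rewrite -piw.
apply: (fibre_power_iso (w' := pcm w' X) _ _ (h' X)).
- by rewrite -pccompE wK.
- by rewrite -pccompE Kw.
Qed.

(* [powF (pcT I) m] is only propositionally fibrewise, so the claim is stated
   for an arbitrary predicate of the data: the induction then replaces [P] by
   its precomposition with the fibre tangent functor, without transport. *)
Lemma powF_pcT (J : Type) (X : C) (E B Q : PC F) (p : Hom E B) (b : Hom Q B)
    (pi : J -> Hom Q E) (m : nat)
    (P : forall E B Q : F X, Hom E B -> Hom Q B -> (J -> Hom Q E) -> Prop) :
  P _ _ _ (fmap (powF (tT (TT X)) m) (pcm p X))
    (fmap (powF (tT (TT X)) m) (pcm b X))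
    (fun i => fmap (powF (tT (TT X)) m) (pcm (pi i) X)) ->
  P _ _ _ (pcm (fmap (powF (pcT I) m) p) X)
    (pcm (fmap (powF (pcT I) m) b) X)
    (fun i => pcm (fmap (powF (pcT I) m) (pi i)) X).
Proof.
elim: m P => [|m IH] P //= h.
exact: (IH (fun _ _ _ p b pi => P _ _ _ (fmap (tT (TT X)) p)
  (fmap (tT (TT X)) b) (fun i => fmap (tT (TT X)) (pi i)))).
Qed.

(** * Joint monicity of projections, and pairings into [T_2 A] and [T (T_2 A)] *)

Lemma tpi_mono (X : C) (A : F X) (K : F X) (w w' : Hom K (tT2 (TT X) A)) :
  tpi1 (TT X) A ∘ w = tpi1 (TT X) A ∘ w' ->
  tpi2 (TT X) A ∘ w = tpi2 (TT X) A ∘ w' -> w = w'.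
Proof. exact: (fibre_power2_uniq (ts_T2 (ts_laws (TT X)) A)). Qed.

(** Preservation of the pullback [T_2 A] by [T], obtained as the case [m = 1] of preservation by
    [powF]. *)
Lemma Ttpi_mono (X : C) (A : F X) (K : F X)
    (w w' : Hom K (tT (TT X) (tT2 (TT X) A))) :
  fmap (tT (TT X)) (tpi1 (TT X) A) ∘ w =
    fmap (tT (TT X)) (tpi1 (TT X) A) ∘ w' ->
  fmap (tT (TT X)) (tpi2 (TT X) A) ∘ w =
    fmap (tT (TT X)) (tpi2 (TT X) A) ∘ w' -> w = w'.
Proof.
have h := ts_Tn_pres (ts_laws (TT X)) (ts_T2 (ts_laws (TT X)) A) 1.
rewrite two_comp in h; exact: (fibre_power2_uniq h).
Qed.

Definition pc_tangent_data : TangentData (PC F) :=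
  MkTangentData pc_p pc_zero pc_pi1 pc_pi2 pc_add pc_l pc_c.

Lemma pc_pairT2 A (Z : PC F) (u v : Hom Z (pcT I A))
    (P : forall X : C, Hom (Z X) (tT2 (TT X) (A X)) -> Prop) :
  (forall X, exists w,
     is_pair (tpi1 (TT X) (A X)) (tpi2 (TT X) (A X)) (pcm u X) (pcm v X) w /\
     P X w) ->
  exists w : Hom Z (pcT2 I A),
    is_pair (pc_pi1 A) (pc_pi2 A) u v w /\ forall X, P X (pcm w X).
Proof.
by apply: (@pc_pair _ _ (pcT2 I A) _ _ _ (pc_pi1 A) (pc_pi2 A) u v P) => X K;
  apply: tpi_mono.
Qed.

Lemma pc_pairTT2 A (Z : PC F) (u v : Hom Z (pcT I (pcT I A)))
    (P : forall X : C, Hom (Z X) (tT (TT X) (tT2 (TT X) (A X))) -> Prop) :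
  (forall X, exists w,
     is_pair (fmap (tT (TT X)) (tpi1 (TT X) (A X)))
       (fmap (tT (TT X)) (tpi2 (TT X) (A X))) (pcm u X) (pcm v X) w /\
     P X w) ->
  exists w : Hom Z (pcT I (pcT2 I A)),
    is_pair (fmap (pcT I) (pc_pi1 A)) (fmap (pcT I) (pc_pi2 A)) u v w /\
    forall X, P X (pcm w X).
Proof.
by apply: (@pc_pair _ _ (pcT I (pcT2 I A)) _ _ _ (fmap (pcT I) (pc_pi1 A))
  (fmap (pcT I) (pc_pi2 A)) u v P) => X K; apply: Ttpi_mono.
Qed.

(** * The tangent axioms *)

Lemma pc_monoid A :
  is_comm_monoid_over (pc_p A) (pc_pi1 A) (pc_pi2 A) (pc_add A) (pc_zero A).
Proof.
have mon X := ts_monoid (ts_laws (TT X)) (A X).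
split.
- by apply: pchom_eq => X; apply: cmo_zero_over (mon X).
- by apply: pchom_eq => X; apply: cmo_add_over (mon X).
- have [w [e h]] := @pc_pairT2 A _ (pc_zero A ∘ pc_p A) (idm _) _
    (fun X => cmo_add0l (mon X)).
  by exists w; split=> //; apply: pchom_eq.
- have [w [e h]] := @pc_pairT2 A _ (idm _) (pc_zero A ∘ pc_p A) _
    (fun X => cmo_add0r (mon X)).
  by exists w; split=> //; apply: pchom_eq.
- have [w [e h]] := @pc_pairT2 A _ (pc_pi2 A) (pc_pi1 A) _
    (fun X => cmo_addC (mon X)).
  by exists w; split=> //; apply: pchom_eq.
- move=> E3 b q /pcTn_pointwise h.
  have h3 X := cmo_addA (mon X) (h X).
  have [|w01 [e01 h01]] := @pc_pairT2 A _ (q (inord 0)) (q (inord 1))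
    (fun _ _ => True).
    by move=> X; have [w [_ [_ [_ [? _ _ _ _]]]]] := h3 X; exists w.
  have [|w12 [e12 h12]] := @pc_pairT2 A _ (q (inord 1)) (q (inord 2))
    (fun _ _ => True).
    by move=> X; have [_ [w [_ [_ [_ ? _ _ _]]]]] := h3 X; exists w.
  have E01 X := conj (congr1 (fun r => pcm r X) e01.1)
    (congr1 (fun r => pcm r X) e01.2).
  have E12 X := conj (congr1 (fun r => pcm r X) e12.1)
    (congr1 (fun r => pcm r X) e12.2).
  (* The fibre law comes with pairings of its own; joint monicity identifies them with the
     components of the global [w01] and [w12]. *)
  have key X : exists wl wr : Hom (E3 X) (tT2 (TT X) (A X)),
      [/\ is_pair (tpi1 (TT X) (A X)) (tpi2 (TT X) (A X))
            (tadd (TT X) (A X) ∘ pcm w01 X) (pcm (q (inord 2)) X) wl,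
          is_pair (tpi1 (TT X) (A X)) (tpi2 (TT X) (A X))
            (pcm (q (inord 0)) X) (tadd (TT X) (A X) ∘ pcm w12 X) wr &
          tadd (TT X) (A X) ∘ wl = tadd (TT X) (A X) ∘ wr].
    have [v01 [v12 [wl [wr [[a1 a2] [b1 b2] hl hr e]]]]] := h3 X.
    have <- : v01 = pcm w01 X.
      by apply: tpi_mono; rewrite ?a1 ?a2; have [] := E01 X.
    have <- : v12 = pcm w12 X.
      by apply: tpi_mono; rewrite ?b1 ?b2; have [] := E12 X.
    by exists wl, wr.
  (* [wr] is glued first, so that the predicate carried along with [wl] can mention its components
     and yield associativity. *)
  have [|wr [er hr]] := @pc_pairT2 A _ (q (inord 0)) (pc_add A ∘ w12)
    (fun _ _ => True).
    by move=> X; have [_ [w [_ ? _]]] := key X; exists w.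
  have [|wl [el hl]] := @pc_pairT2 A _ (pc_add A ∘ w01) (q (inord 2))
    (fun X w => tadd (TT X) (A X) ∘ w = tadd (TT X) (A X) ∘ pcm wr X).
    move=> X; have [w [w' [? [r1 r2] e]]] := key X; exists w; split=> //.
    rewrite e; congr (_ ∘ _); apply: tpi_mono; rewrite ?r1 ?r2.
      exact: (congr1 (fun r => pcm r X) (esym er.1)).
    exact: (congr1 (fun r => pcm r X) (esym er.2)).
  by exists w01, w12, wl, wr; split=> //; apply: pchom_eq.
Qed.

Lemma pc_tangent_structure : is_tangent_structure pc_tangent_data.
Proof.
have L X := ts_laws (TT X).
split.
- move=> A; apply: pc_fibre_power => X; rewrite (two_comp (fun r => pcm r X)).
  exact: ts_T2 (L X) (A X).
- move=> A n; have [Q [b [pi h]]] := pcTn_exists A n.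
  by exists Q, b, pi; apply: pc_fibre_power.
(* The given power is made fibrewise, preserved in each fibre, and reassembled in [PC F]; [powF_pcT]
   matches the two iterates of [T]. *)
- move=> A n Q b pi h m; apply: pc_fibre_power => X.
  exact: (@powF_pcT _ X _ _ _ (pc_p A) b pi m
    (fun _ _ _ p b pi => is_fibre_power p b pi)
    (ts_Tn_pres (L X) (pcTn_pointwise h X) m)).
- exact: pc_monoid.
- by move=> A; apply: pchom_eq => X; apply: ts_l_p (L X) (A X).
- move=> A; have [w [e h]] := @pc_pairTT2 A _ (pc_l A ∘ pc_pi1 A)
    (pc_l A ∘ pc_pi2 A) _ (fun X => ts_l_add (L X) (A X)).
  by exists w; split=> //; apply: pchom_eq.
- by move=> A; apply: pchom_eq => X; apply: ts_l_zero (L X) (A X).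
- by move=> A; apply: pchom_eq => X; apply: ts_c_p (L X) (A X).
- move=> A; have [w [e h]] := @pc_pairT2 (pcT I A) _
    (pc_c A ∘ fmap (pcT I) (pc_pi1 A)) (pc_c A ∘ fmap (pcT I) (pc_pi2 A))
    _ (fun X => ts_c_add (L X) (A X)).
  by exists w; split=> //; apply: pchom_eq.
- by move=> A; apply: pchom_eq => X; apply: ts_c_zero (L X) (A X).
- by move=> A; apply: pchom_eq => X; apply: ts_cc (L X) (A X).
- by move=> A; apply: pchom_eq => X; apply: ts_cl (L X) (A X).
- by move=> A; apply: pchom_eq => X; apply: ts_ll (L X) (A X).
- by move=> A; apply: pchom_eq => X; apply: ts_ccc (L X) (A X).
- by move=> A; apply: pchom_eq => X; apply: ts_ccl (L X) (A X).
(* The predicate carried along is the equalizer property itself, so the glued pairing is an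
   equalizer in every fibre and hence in [PC F]. *)
- move=> A; have [w [e h]] := @pc_pairTT2 A _ (pc_l A ∘ pc_pi1 A)
    (pc_zero (pcT I A) ∘ pc_pi2 A) _ (fun X => ts_univ (L X) (A X)).
  by exists w; split=> //; apply: pc_equalizer.
Qed.

End TangentPseudoCones.

Theorem theorem3p34 (C : Category) (F : PseudoFunctor C) (I : TangentIndexing F) :
  exists (p : NatTrans (pcT I) (idF (PC F)))
         (zero : NatTrans (idF (PC F)) (pcT I))
         (pi1 pi2 add : NatTrans (pcT2 I) (pcT I))
         (l : NatTrans (pcT I) (compF (pcT I) (pcT I)))
         (c : NatTrans (compF (pcT I) (pcT I)) (compF (pcT I) (pcT I))),
    is_tangent_structure (MkTangentData p zero pi1 pi2 add l c) /\
    forall (A : PC F) (X : C),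
      pcm (p A) X = tp (ti_ts I X) (A X) /\
      pcm (zero A) X = tzero (ti_ts I X) (A X) /\
      pcm (pi1 A) X = tpi1 (ti_ts I X) (A X) /\
      pcm (pi2 A) X = tpi2 (ti_ts I X) (A X) /\
      pcm (add A) X = tadd (ti_ts I X) (A X) /\
      pcm (l A) X = tl (ti_ts I X) (A X) /\
      pcm (c A) X = tc (ti_ts I X) (A X).
Proof.
exists (pc_p I), (pc_zero I), (pc_pi1 I), (pc_pi2 I), (pc_add I), (pc_l I).
exists (pc_c I); split; first exact: pc_tangent_structure.
by [].
Qed.
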